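(* Let $1\leqslant p<2$ and $1\leqslant q\leqslant p$. If $\boldsymbol{y}\in\mathbb{R}^d\setminus\mathcal{S}_p$, then $C_{p,q}(\mathbf{T}_{p,q}(\boldsymbol{y}))\leqslant C_{p,q}(\boldsymbol{y})$, with equality only when $\mathbf{T}_{p,q}(\boldsymbol{y})=\boldsymbol{y}$.
   Context: Data: $\boldsymbol{x}_1,\dots,\boldsymbol{x}_m\in\mathbb{R}^d$ are fixed data points, distinct and non-collinear, with weights $\eta_1,\dots,\eta_m>0$. Superscript $(t)$ denotes the $t$-th coordinate, $1\leqslant t\leqslant d$, and $\|\cdot\|_p$ is the $\ell_p$ norm on $\mathbb{R}^d$. Cost function: $C_{p,q}(\boldsymbol{y}):=\sum_{i=1}^m \eta_i^q\|\boldsymbol{y}-\boldsymbol{x}_i\|_p^q$ for $\boldsymbol{y}\in\mathbb{R}^d$. Singular set: $\mathcal{S}_p:=\{\boldsymbol{y}\in\mathbb{R}^d : \exists i\in\{1,\dots,m\},\ \exists t\in\{1,\dots,d\}\text{ such that } y^{(t)}=x_i^{(t)}\}$. Operator: for $\boldsymbol{y}\notin\mathcal{S}_p$, $\mathbf{T}_{p,q}(\boldsymbol{y})\in\mathbb{R}^d$ is defined coordinatewise by $$\big(\mathbf{T}_{p,q}(\boldsymbol{y})\big)^{(t)}:=\frac{\sum_{i=1}^m \eta_i^q\|\boldsymbol{y}-\boldsymbol{x}_i\|_p^{q-p}|y^{(t)}-x_i^{(t)}|^{p-2}x_i^{(t)}}{\sum_{i=1}^m \eta_i^q\|\boldsymbol{y}-\boldsymbol{x}_i\|_p^{q-p}|y^{(t)}-x_i^{(t)}|^{p-2}},\qquad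 1\leqslant t\leqslant d.$$ *)

(* Defs.v *)
From mathcomp Require Import all_boot all_order all_algebra.
From mathcomp Require Import classical_sets reals exp.

Set Implicit Arguments.
Unset Strict Implicit.
Unset Printing Implicit Defensive.

Import Order.TTheory GRing.Theory Num.Theory.

Local Open Scope classical_set_scope.
Local Open Scope ring_scope.

(* The library norm on 'rV[R]_d is the sup norm, hence a separate definition. *)
Definition lp_norm (R : realType) (d : nat) (p : R) (v : 'rV[R]_d) : R :=
  (\sum_(t < d) `|v ord0 t| `^ p) `^ p^-1.

Definition collinear (R : realType) (m d : nat) (x : 'I_m -> 'rV[R]_d) : Prop :=
  exists a v : 'rV[R]_d,
    v != 0 /\ forall i : 'I_m, exists c : R, x i = a + c *: v.

Definition cost (R : realType) (m d : nat) (x : 'I_m -> 'rV[R]_d)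
    (eta : 'I_m -> R) (p q : R) (y : 'rV[R]_d) : R :=
  \sum_(i < m) eta i `^ q * lp_norm p (y - x i) `^ q.

Definition singular_set (R : realType) (m d : nat) (x : 'I_m -> 'rV[R]_d) :
    set 'rV[R]_d :=
  [set y | exists (i : 'I_m) (t : 'I_d), y ord0 t = x i ord0 t].

Definition opT_coef (R : realType) (m d : nat) (x : 'I_m -> 'rV[R]_d)
    (eta : 'I_m -> R) (p q : R) (y : 'rV[R]_d) (t : 'I_d) (i : 'I_m) : R :=
  eta i `^ q * lp_norm p (y - x i) `^ (q - p)
    * `|y ord0 t - x i ord0 t| `^ (p - 2).

(* Totalized: only meaningful for y outside singular_set x, where every base
   of a real power in opT_coef is positive and, for m > 0, so is the denominator. *)
Definition opT (R : realType) (m d : nat) (x : 'I_m -> 'rV[R]_d)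
    (eta : 'I_m -> R) (p q : R) (y : 'rV[R]_d) : 'rV[R]_d :=
  \row_(t < d) ((\sum_(i < m) opT_coef x eta p q y t i * x i ord0 t)
                / (\sum_(i < m) opT_coef x eta p q y t i)).

(* Main.v *)
Require Import Defs.
From mathcomp Require Import all_boot all_order all_algebra.
From mathcomp Require Import classical_sets reals exp.
From mathcomp Require Import ring.

(** The operator is a majorize-minimize step.  For an exponent [r <= 1] the
    function [b |-> b `^ r] is concave, so it lies below its tangent at any
    [a > 0] ([powR_le_tangent]).  This is used twice.

    With [r = q / p] at the p-th power of the lp norm, it bounds the q-th power
    of the norm by a function that is affine in the powers [`|w t| `^ p]; with
    [r = p / 2] at a squared coordinate, it bounds each of these by a function
    that is affine in [w t ^+ 2].  Hence ([lp_norm_powR_le_quadratic]) the cost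
    lies below a separable quadratic that touches it at [y], whose weights on
    the coordinate [t] are, up to the factor [q / 2], the coefficients
    [opT_coef] defining the operator.  The minimizer of a weighted sum of
    squares is the weighted mean of the data ([weighted_sum_sqrB]), which is
    [opT y], and by completing the square the decrease of the quadratic is
    [q / 2 * \sum_t (\sum_i opT_coef t i) * (opT y t - y t) ^+ 2].

    So this quantity bounds the decrease of the cost from below
    ([cost_opT_descent]).  Off the singular set all the coefficients are
    positive: the decrease is nonnegative, and if it is zero then every
    coordinate of [opT y] is that of [y].  In positive dimension,
    non-collinearity guarantees that there is at least one data point, hence
    that the denominators of the weighted means are positive. *)

Set Implicit Arguments.
Unset Strict Implicit.
Unset Printing Implicit Defensive.

Import Order.TTheory GRing.Theory Num.Theory.

Local Open Scope classical_set_scope.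
Local Open Scope ring_scope.

(** This is Young's inequality for the exponents [r^-1] and [(1 - r)^-1],
    [b `^ r * a `^ (1 - r) <= r * b + (1 - r) * a], divided by [a `^ (1 - r)]. *)
Lemma powR_le_tangent (R : realType) (a b r : R) :
  0 < a -> 0 <= b -> 0 < r -> r <= 1 ->
  b `^ r <= a `^ r + r * a `^ (r - 1) * (b - a).
Proof.
move=> a0 b0 r0; rewrite le_eqVlt => /predU1P[->|r1].
  by rewrite subrr powRr0 !powRr1 ?(ltW a0)// !mul1r subrKC.
have s0 : 0 < 1 - r by rewrite subr_gt0.
have young : b `^ r * a `^ (1 - r) <= b * r + a * (1 - r).
  have := @conjugate_powR R (b `^ r) (a `^ (1 - r)) r^-1 (1 - r)^-1
    (powR_ge0 _ _) (powR_ge0 _ _).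
  rewrite !invr_gt0 !invrK -!powRrM !mulfV ?gt_eqF// !powRr1 ?(ltW a0)//.
  by apply => //; rewrite subrKC.
have cancel_a : a `^ (1 - r) * a `^ (r - 1) = 1.
  by rewrite -[r - 1]opprB powRN mulfV// gt_eqF// powR_gt0.
have := ler_wpM2r (powR_ge0 a (r - 1)) young.
rewrite -[X in X <= _]mulrA cancel_a mulr1 -(mulr_powRB1 (ltW a0) r0).
by move=> /le_trans; apply; rewrite le_eqVlt; apply/orP; left; apply/eqP; ring.
Qed.

Lemma powR_sqr (R : realType) (u p : R) : (u ^+ 2) `^ (p / 2) = `|u| `^ p.
Proof.
by rewrite -real_normK ?num_real// -powR_mulrn// -powRrM mulrC divfK ?pnatr_eq0.
Qed.

(** A power of exponent at most 2 of the absolute value is a concave function of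
    the square. *)
Lemma norm_powR_le_quadratic (R : realType) (u w p : R) :
  u != 0 -> 0 < p -> p <= 2 ->
  `|w| `^ p <= `|u| `^ p + p / 2 * (`|u| `^ (p - 2) * (w ^+ 2 - u ^+ 2)).
Proof.
move=> u0 p0 p2.
have e : (p - 2) / 2 = p / 2 - 1 by field.
rewrite -[`|w| `^ p]powR_sqr -[`|u| `^ p]powR_sqr -[`|u| `^ _]powR_sqr e mulrA.
apply: powR_le_tangent; rewrite ?sqr_ge0 ?exprn_even_gt0 ?divr_gt0//.
by rewrite ler_pdivrMr ?mul1r.
Qed.

Lemma lp_norm_gt0 (R : realType) (d : nat) (p : R) (v : 'rV[R]_d) (t : 'I_d) :
  v ord0 t != 0 -> 0 < lp_norm p v.
Proof.
move=> vt0; apply: powR_gt0; rewrite (bigD1 t)//=.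
by rewrite ltr_wpDr ?powR_gt0 ?normr_gt0 ?sumr_ge0// => s _; exact: powR_ge0.
Qed.

(** For [a] and [b] the p-th powers of two lp norms, this is the tangent bound
    for the exponent [q / p], its slope being read as a power of the norm. *)
Lemma powR_root_le_affine (R : realType) (a b p q : R) :
  0 < a -> 0 <= b -> 0 < q -> q <= p ->
  (b `^ p^-1) `^ q <=
    (a `^ p^-1) `^ q + q / p * (a `^ p^-1) `^ (q - p) * (b - a).
Proof.
move=> a0 b0 q0 qp; have p0 := lt_le_trans q0 qp.
rewrite -!powRrM ![p^-1 * _]mulrC mulrBl mulfV ?gt_eqF//.
by apply: powR_le_tangent; rewrite ?divr_gt0// ler_pdivrMr ?mul1r.
Qed.

(** The two tangent bounds are chained: the inner one is inserted into the outer
    one, whose slope is nonnegative. *)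
Lemma lp_norm_powR_le_quadratic (R : realType) (d : nat) (p q : R)
    (u w : 'rV[R]_d) :
  0 < q -> q <= p -> p <= 2 -> (forall t, u ord0 t != 0) ->
  lp_norm p w `^ q <= lp_norm p u `^ q +
    q / 2 * (lp_norm p u `^ (q - p) *
      \sum_(t < d) `|u ord0 t| `^ (p - 2) * (w ord0 t ^+ 2 - u ord0 t ^+ 2)).
Proof.
move=> q0 qp p2 u0; have p0 := lt_le_trans q0 qp.
case: d u w u0 => [|d] u w u0.
  by rewrite big_ord0 !mulr0 addr0 (thinmx0 w) (thinmx0 u).
set Q := \sum_t _.
pose A := \sum_t `|u ord0 t| `^ p; pose B := \sum_t `|w ord0 t| `^ p.
have A0 : 0 < A.
  rewrite /A (bigD1 ord0)//= ltr_wpDr ?powR_gt0 ?normr_gt0 ?sumr_ge0// => s _.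
  exact: powR_ge0.
have B0 : 0 <= B by apply: sumr_ge0 => t _; exact: powR_ge0.
apply: le_trans (powR_root_le_affine A0 B0 q0 qp) _.
rewrite -/(lp_norm p u) lerD2l.
have BA : B - A <= p / 2 * Q.
  rewrite lerBlDl /B /A /Q mulr_sumr -big_split; apply: ler_sum => t _ /=.
  exact: norm_powR_le_quadratic.
have slope0 : 0 <= q / p * lp_norm p u `^ (q - p).
  by rewrite mulr_ge0 ?powR_ge0 ?divr_ge0 ?ltW.
apply: le_trans (ler_wpM2l slope0 BA) _.
rewrite le_eqVlt; apply/orP; left; apply/eqP.
by field; rewrite gt_eqF.
Qed.

(** Completing the square: [z] being the weighted mean is the vanishing of the
    derivative at [z] of the weighted sum of squared distances. *)
Lemma weighted_sum_sqrB (R : comRingType) (I : finType) (c a : I -> R) (z y : R) :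
  (\sum_i c i) * z = \sum_i c i * a i ->
  \sum_i c i * ((z - a i) ^+ 2 - (y - a i) ^+ 2) =
  - ((\sum_i c i) * (z - y) ^+ 2).
Proof.
move=> mean.
have expand i : c i * ((z - a i) ^+ 2 - (y - a i) ^+ 2) =
    c i * (z ^+ 2 - y ^+ 2) + c i * a i * (2 * (y - z)) by ring.
under eq_bigr => i _ do rewrite expand.
by rewrite big_split /= -!mulr_suml -mean; ring.
Qed.

Section Descent.
Variables (R : realType) (m d : nat) (x : 'I_m -> 'rV[R]_d) (eta : 'I_m -> R).
Variables (p q : R) (y : 'rV[R]_d).
Hypothesis eta_gt0 : forall i, 0 < eta i.
Hypothesis y_nonsing : (~` singular_set x) y.

Let coord_neq0 i t : (y - x i) ord0 t != 0.
Proof.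
rewrite !mxE subr_eq0; apply/eqP => yx; apply: y_nonsing.
by exists i, t.
Qed.

Lemma opT_coef_gt0 t i : 0 < opT_coef x eta p q y t i.
Proof.
have yx := coord_neq0 i t.
have norm_gt0 := lp_norm_gt0 p yx.
rewrite /opT_coef !mulr_gt0// powR_gt0//.
by rewrite normr_gt0; move: yx; rewrite !mxE.
Qed.

Lemma sum_opT_coef_gt0 t : (0 < m)%N -> 0 < \sum_(i < m) opT_coef x eta p q y t i.
Proof.
move=> m0; rewrite (bigD1 (Ordinal m0))//=.
by rewrite ltr_wpDr ?opT_coef_gt0 ?sumr_ge0// => i _; exact/ltW/opT_coef_gt0.
Qed.

Lemma opT_mean t : (0 < m)%N ->
  (\sum_(i < m) opT_coef x eta p q y t i) * opT x eta p q y ord0 t =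
  \sum_(i < m) opT_coef x eta p q y t i * x i ord0 t.
Proof. by move=> m0; rewrite mxE mulrC divfK// gt_eqF// sum_opT_coef_gt0. Qed.

(** The quadratic majorants of the terms of the cost are summed, and the double
    sum is then grouped by coordinates, each of which is minimized at [opT]. *)
Lemma cost_opT_descent : (0 < m)%N -> 0 < q -> q <= p -> p <= 2 ->
  cost x eta p q (opT x eta p q y) +
    q / 2 * \sum_(t < d) (\sum_(i < m) opT_coef x eta p q y t i) *
                         (opT x eta p q y ord0 t - y ord0 t) ^+ 2
  <= cost x eta p q y.
Proof.
move=> m0 q0 qp p2; set z := opT x eta p q y.
pose change t i := opT_coef x eta p q y t i *
  ((z ord0 t - x i ord0 t) ^+ 2 - (y ord0 t - x i ord0 t) ^+ 2).
have -> : \sum_(t < d) (\sum_(i < m) opT_coef x eta p q y t i) *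
    (z ord0 t - y ord0 t) ^+ 2 = - \sum_(i < m) \sum_(t < d) change t i.
  rewrite exchange_big -sumrN; apply: eq_bigr => t _.
  by rewrite (weighted_sum_sqrB _ (opT_mean t m0)) opprK.
rewrite mulrN lerBlDr mulr_sumr -big_split; apply: ler_sum => i _ /=.
have := @lp_norm_powR_le_quadratic R d p q _ (z - x i) q0 qp p2 (coord_neq0 i).
move=> /(ler_wpM2l (powR_ge0 (eta i) q)) /le_trans; apply.
rewrite mulrDr lerD2l le_eqVlt; apply/orP; left; apply/eqP.
rewrite mulrCA; congr (_ * _); rewrite mulrA mulr_sumr.
have coordB (v : 'rV[R]_d) t : (v - x i) ord0 t = v ord0 t - x i ord0 t.
  by rewrite !mxE.
by apply: eq_bigr => t _; rewrite !coordB mulrA.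
Qed.

End Descent.

Theorem theorem1 (R : realType) (m d : nat) (x : 'I_m -> 'rV[R]_d)
    (eta : 'I_m -> R) (p q : R) (y : 'rV[R]_d)
    (x_distinct : injective x) (x_noncollinear : ~ collinear x)
    (eta_gt0 : forall i : 'I_m, 0 < eta i)
    (p_ge1 : 1 <= p) (p_lt2 : p < 2) (q_ge1 : 1 <= q) (q_le_p : q <= p)
    (y_nonsing : (~` singular_set x) y) :
  cost x eta p q (opT x eta p q y) <= cost x eta p q y /\
  (cost x eta p q (opT x eta p q y) = cost x eta p q y ->
   opT x eta p q y = y).
Proof.
have q0 : 0 < q := lt_le_trans ltr01 q_ge1.
have [d0|d_gt0] := posnP d.
  by move: x y {x_distinct x_noncollinear y_nonsing}; rewrite d0 => x y;
    rewrite (thinmx0 (opT _ _ _ _ _)) (thinmx0 y).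
have m_gt0 : (0 < m)%N.
  (* An empty family lies on every line. *)
  rewrite lt0n; apply/eqP => m0; apply: x_noncollinear.
  exists 0, (const_mx 1); split; last first.
    by move=> i; exfalso; have := ltn_ord i; rewrite [X in (_ < X)%N]m0.
  apply/eqP => /matrixP/(_ ord0 (Ordinal d_gt0)); rewrite !mxE.
  by move/eqP; rewrite oner_eq0.
have := cost_opT_descent eta_gt0 y_nonsing m_gt0 q0 q_le_p (ltW p_lt2).
set z := opT x eta p q y; set S := \sum_(t < d) _ => descent.
have term_ge0 (t : 'I_d) : true ->
    0 <= (\sum_(i < m) opT_coef x eta p q y t i) * (z ord0 t - y ord0 t) ^+ 2.
  by move=> _; rewrite mulr_ge0 ?sqr_ge0// ltW// sum_opT_coef_gt0.
have S0 : 0 <= S by exact: sumr_ge0.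
have qS0 : 0 <= q / 2 * S by rewrite mulr_ge0// divr_ge0 ?ltW.
split; first by apply: le_trans descent; rewrite lerDl.
move=> cost_eq; move: descent; rewrite cost_eq gerDl => qS_le0.
have S_eq0 : S = 0.
  by apply: le_anti; rewrite S0 andbT -(@pmulr_rle0 _ (q / 2)) ?divr_gt0.
apply/rowP => t; apply/eqP; rewrite -subr_eq0 -sqrf_eq0.
have weight_gt0 := sum_opT_coef_gt0 p q eta_gt0 y_nonsing t m_gt0.
have /eqP := psumr_eq0P term_ge0 S_eq0 (i := t) isT.
by rewrite mulf_eq0 (gt_eqF weight_gt0).
Qed.
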